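(* Let $n\ge 1$ and $X=(x_1,\ldots,x_n)$. Suppose that $P(X)$ is a symmetric function (i.e. a symmetric polynomial in the variables $x_1,\ldots,x_n$) which is homogeneous of degree $n$, and that $$P(X)=\sum_{\alpha\Vdash n} a_\alpha F_\alpha(X),$$ where the sum is over all compositions $\alpha$ of $n$, the $a_\alpha$ are scalars in the coefficient ring, and $F_\alpha(X)$ is Gessel's fundamental quasisymmetric function. Then $$P(X)=\sum_{\alpha\Vdash n} a_\alpha\, s_{\alpha}(X),$$ where $s_\alpha(X)=s_{\tilde\alpha}(X)$ is the Schur function indexed by the composition $\alpha$ padded with zeros to length $n$, defined by the ratio-of-determinants formula.
   Context: Coefficients lie in a fixed commutative ring $K$ with unit (e.g. $\mathbb{Z}$, $\mathbb{Q}$, $\mathbb{Q}(q,t)$). A composition $\alpha=(\alpha_1,\ldots,\alpha_k)$ of $n$, written $\alpha\Vdash n$, is a finite sequence of positive integers with $\sum_i\alpha_i=n$. A weak composition of $n$ into $n$ parts is a sequence $\gamma=(\gamma_1,\ldots,\gamma_n)$ of non-negative integers with $\sum_i\gamma_i=n$. For a composition $\alpha=(\alpha_1,\ldots,\alpha_k)$ of $n$: - $Set(\alpha)=\{\alpha_1,\ \alpha_1+\alpha_2,\ \ldots,\ \alpha_1+\cdots+\alpha_{k-1}\}\subseteq\{1,\ldots,n-1\}$. - $\tilde\alpha=(\alpha_1,\ldots,\alpha_k,0,\ldots,0)$ is the weak composition of $n$ into $n$ parts obtained by appending $n-k$ zeros at the end of $\alpha$. - The fundamental quasisymmetric function is $$F_\alpha(X)=\sum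 x_{a_1}x_{a_2}\cdots x_{a_n},$$ the sum being over all integer sequences $1\le a_1\le a_2\le\cdots\le a_n\le n$ such that $a_i<a_{i+1}$ whenever $i\in Set(\alpha)$. For a weak composition $\gamma=(\gamma_1,\ldots,\gamma_n)$ of $n$ into $n$ parts, the Schur function is $$s_\gamma(X)=\frac{\Delta_\gamma(X)}{\Delta(X)},\qquad \Delta_\gamma(X)=\det\left(x_i^{\gamma_j+n-j}\right)_{1\le i,j\le n},\qquad \Delta(X)=\det\left(x_i^{n-j}\right)_{1\le i,j\le n}.$$ This is a polynomial with integer coefficients (viewed in $K[x_1,\ldots,x_n]$). The entries of $\gamma$ are not required to be weakly decreasing. *)

(* Defs.v *)
From HB Require Import structures.
From mathcomp Require Import all_boot all_order all_fingroup all_algebra.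
From mathcomp.multinomials Require Import mpoly.

Set Implicit Arguments.
Unset Strict Implicit.
Unset Printing Implicit Defensive.

Import GRing.Theory.
Local Open Scope ring_scope.

Definition is_composition (n : nat) (s : seq nat) : bool :=
  all (fun p => 0 < p)%N s && (sumn s == n).

Record composition (n : nat) : Type := Composition {
  parts :> seq nat;
  partsP : is_composition n parts
}.

HB.instance Definition _ n := [isSub of composition n for @parts n].
HB.instance Definition _ n := [Countable of composition n by <:].

Lemma size_composition n (al : composition n) : (size al <= n)%N.
Proof.
case: al => s /= /andP[+ /eqP <-]; elim: s => //= p s IHs /andP[p_gt0 /IHs].
by move=> le_s; rewrite -addn1 addnC leq_add.
Qed.

Lemma composition_part_le n (al : composition n) p : p \in parts al -> (p <= n)%N.
Proof.
case: al => s /= /andP[_ /eqP <-]; elim: s => //= q s IHs.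
rewrite inE => /predU1P[->|/IHs le_p]; first exact: leq_addr.
exact: leq_trans le_p (leq_addl _ _).
Qed.

(* A composition of n has at most n parts, each at most n. *)
Definition composition_bseq n (al : composition n) : n.-bseq 'I_n.+1 :=
  insub_bseq n [seq inord p | p <- parts al].

Definition bseq_composition n (b : n.-bseq 'I_n.+1) : option (composition n) :=
  insub [seq val i | i <- b].

Lemma composition_bseqK n : pcancel (@composition_bseq n) (@bseq_composition n).
Proof.
move=> al; rewrite /bseq_composition /composition_bseq /insub_bseq.
rewrite insubdK; last by rewrite -topredE /= size_map size_composition.
suff ->: [seq val i | i <- [seq inord p : 'I_n.+1 | p <- parts al]] = val al
  by rewrite valK.
rewrite -map_comp -[RHS]map_id; apply/eq_in_map => p /composition_part_le le_p.
by rewrite /= inordK.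
Qed.

HB.instance Definition _ n : isFinite (composition n) :=
  PCanIsFinite (@composition_bseqK n).

Definition comp_set (s : seq nat) : seq nat :=
  [seq sumn (take i s) | i <- iota 1 (size s).-1].

Definition pad n (al : composition n) : 'X_{1..n} :=
  [multinom nth 0%N al i | i < n].

Lemma mdeg_pad n (al : composition n) : mdeg (pad al) = n.
Proof.
rewrite mdegE (eq_bigr (fun i : 'I_n => nth 0%N al i)); last first.
  by move=> i _; rewrite mnmE.
rewrite -(big_mkord xpredT (nth 0%N al)) (big_cat_nat (leq0n _) (size_composition al)) //=.
rewrite [X in (_ + X)%N]big_nat_cond [X in (_ + X)%N]big1 ?addn0; last first.
  by move=> i /andP[/andP[le_i _] _]; rewrite nth_default.
rewrite -(big_nth 0%N xpredT id) -sumnE.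
by case: (al) => s /= /andP[_ /eqP].
Qed.

(* Positions in a are counted from 0 and those in comp_set from 1: a i and
   a i.+1 are the (i+1)-st and (i+2)-nd terms, so i.+1 is what is tested. *)
Definition F_seq n (al : composition n) (a : {ffun 'I_n -> 'I_n}) : bool :=
  [forall i : 'I_n, forall j : 'I_n, (j == i.+1 :> nat) ==>
     (a i <= a j)%N && ((i.+1 \in comp_set al) ==> (a i < a j)%N)].

Definition fundamental (K : comNzRingType) n (al : composition n) : {mpoly K[n]} :=
  \sum_(a : {ffun 'I_n -> 'I_n} | F_seq al a) \prod_(i < n) 'X_(a i).

(* With 0-based columns the exponent n - j becomes n - j.+1. *)
Definition alternant n (g : 'X_{1..n}) : {mpoly int[n]} :=
  \det (\matrix_(i < n, j < n) 'X_i ^+ (g j + (n - j.+1))).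

Definition vandermonde n : {mpoly int[n]} :=
  \det (\matrix_(i < n, j < n) 'X_i ^+ (n - j.+1)).

Lemma vandermondeE n : exists b : bool,
  vandermonde n = (-1) ^+ b * \prod_(i < n) \prod_(j < n | (i < j)%N) ('X_j - 'X_i).
Proof.
pose s := perm (@rev_ord_inj n); exists (s^-1)%g.
set M := Vandermonde n (\row_(i < n) ('X_i : {mpoly int[n]})).
rewrite /vandermonde; set A := (X in \det X).
have -> : A = col_perm s M^T.
  by apply/matrixP => i j; rewrite !mxE permE.
rewrite col_permE det_mulmx det_perm det_tr det_Vandermonde mulrC.
congr (_ * _); apply: eq_bigr => i _; apply: eq_bigr => j _.
by rewrite !mxE.
Qed.

Lemma vandermonde_neq0 n : vandermonde n != 0.
Proof.
have [b ->] := vandermondeE n; rewrite mulf_neq0 ?signr_eq0 //.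
apply/prodf_neq0 => i _; apply/prodf_neq0 => j lt_ij.
apply/eqP => /(congr1 (mcoeff U_(j)%MM)).
rewrite mcoeffB !mcoeffXU mcoeff0 eqxx.
by have /negPf-> : i != j by rewrite neq_ltn lt_ij.
Qed.

(* Reduce T^(e j) modulo the monic polynomial \prod_i (T - x i). *)
Lemma power_matrix_factor (A : comNzRingType) n (x : 'I_n -> A) (e : 'I_n -> nat) :
  exists C : 'M[A]_n,
    \matrix_(i < n, j < n) x i ^+ e j
    = (\matrix_(i < n, j < n) x i ^+ (n - j.+1)) *m C.
Proof.
pose w : {poly A} := \prod_(i < n) ('X - (x i)%:P).
have w_mon : w \is monic by apply: monic_prod_XsubC.
have sz_w : size w = n.+1.
  by rewrite size_prod_XsubC [index_enum _]unlock -enumT size_enum_ord.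
have w0 i : w.[x i] = 0.
  by rewrite horner_prod (bigD1 i) //= hornerXsubC subrr mul0r.
pose r a := Pdiv.Ring.rmodp 'X^a w.
have sz_r a : (size (r a) <= n)%N.
  by rewrite -ltnS -sz_w Pdiv.Ring.ltn_rmodpN0 // monic_neq0.
have rE a i : (r a).[x i] = x i ^+ a.
  have /(congr1 (horner^~ (x i))) := Pdiv.RingMonic.rdivp_eq w_mon 'X^a.
  by rewrite /= hornerD hornerM w0 mulr0 add0r hornerXn.
exists (\matrix_(k, j) (r (e j))`_(n - k.+1)).
apply/matrixP => i j; rewrite !mxE -rE (horner_coef_wide _ (sz_r _)).
rewrite (reindex_inj rev_ord_inj) /=; apply: eq_bigr => k _.
by rewrite !mxE mulrC.
Qed.

Lemma alternant_divisible n (g : 'X_{1..n}) :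
  exists s, s * vandermonde n == alternant g.
Proof.
have [C defC] := power_matrix_factor (fun i => 'X_i : {mpoly int[n]})
  (fun j => (g j + (n - j.+1))%N).
by exists (\det C); rewrite /alternant defC det_mulmx mulrC.
Qed.

(* The quotient alternant g / vandermonde n in the domain Z[x_1, ..., x_n]. *)
Definition schur_int n (g : 'X_{1..n}) : {mpoly int[n]} :=
  xchoose (alternant_divisible g).

Lemma schur_intE n (g : 'X_{1..n}) :
  schur_int g * vandermonde n = alternant g.
Proof. exact/eqP/(xchooseP (alternant_divisible g)). Qed.

Lemma schur_int_unique n (g : 'X_{1..n}) (s : {mpoly int[n]}) :
  s * vandermonde n = alternant g -> s = schur_int g.
Proof. by rewrite -schur_intE => /(mulIf (vandermonde_neq0 n)). Qed.

Definition schur (K : comNzRingType) n (g : 'X_{1..n}) : {mpoly K[n]} :=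
  map_mpoly (intr : int -> K) (schur_int g).

(* Main.v *)
Require Import Defs.
From HB Require Import structures.
From mathcomp Require Import all_boot all_order all_fingroup all_algebra.
From mathcomp.multinomials Require Import mpoly.
From mathcomp Require Import zify.

(** Write [Delta_g] for [alternant g] and [s_g] for the Schur function of a
weak composition [g] with [n] parts.  Both sides of the theorem are values of
the linear map [L] that sends a polynomial [Q] to the sum of
[Q@_m *: s_m] over the monomials [m].

On a symmetric polynomial [L] is the identity.  Indeed [Delta_m] is the
signed sum of the images under permutations of the variables of
[x^m * x^delta], with [delta] the staircase [(n-1, ..., 1, 0)]; summing
[P@_m * Delta_m] over [m] therefore antisymmetrizes [P * x^delta], which gives
[P * Delta_0] because [P] is invariant ([sum_coeff_alternant]).  The
Vandermonde determinant [Delta_0] is regular over every commutative ring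
([lreg_vandermonde]), so it can be cancelled ([symmetric_schur_expansion]).

On fundamental quasisymmetric functions, [L] sends each [F_al] to [s_al]
([schur_fundamental]).  The monomials of [F_al] are the [x^g]
where [g] runs over the weak compositions of [n] whose partial sums include all
the partial sums of [al] ([F_seqP]).  So it has to be shown
that the sum of [Delta_g] over these [g] is [Delta_al]
([sum_fundamental_alternant]).  All terms with [g] different from the padded
[al] cancel in pairs.  Let [i] be the first index where the partial sums of [g]
and [al] differ; there the partial sum of [g] is too small, and [al]'s [i]-th
partial sum is reached by [g] only after some later part, say the one with
index [j1 = j0 + 1].  Replace the two parts [(g j0, g j1)] by
[(g j1 - 1, g j0 + 1)].  This is the straightening rule: in the exponents
[g + delta] it exchanges two columns, so [Delta_g] changes sign
([alternant_swap]).  Among the partial sums of [g], only the one just before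
the [i]-th partial sum of [al] is reached gets changed, and it stays below that
value, so the new weak composition is again a monomial of [F_al] and leads to
the same [i] and [j1] ([pivot_swap], [admissible_swap]). *)

Set Implicit Arguments.
Unset Strict Implicit.
Unset Printing Implicit Defensive.

Import Order.TTheory GRing.Theory.
Local Open Scope ring_scope.

(** * Symmetric polynomials in terms of Schur functions *)

Definition staircase n : 'X_{1..n} := [multinom (n - j.+1)%N | j < n].

(** The Leibniz formula, read on the transpose so that each permutation acts on
the variables and leaves the exponents alone. *)
Lemma map_alternant (K : comNzRingType) n (g : 'X_{1..n}) :
  map_mpoly (intr : int -> K) (alternant g)
  = \sum_(s : 'S_n) (-1) ^+ s * msym s 'X_[(g + staircase n)%MM].
Proof.
rewrite /alternant -det_map_mx -det_tr; apply: eq_bigr => s _; congr (_ * _).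
rewrite msymX (mpolyXE _ s); apply: eq_bigr => j _.
by rewrite !mxE rmorphXn /= map_mpolyX !mnmE permK.
Qed.

Lemma vandermonde_alternant n : vandermonde n = alternant (0%MM : 'X_{1..n}).
Proof.
by congr (\det _); apply/matrixP => i j; rewrite !mxE mnm0E.
Qed.

(** After exchanging the two sums, the inner one is the image of [P] under a
permutation of the variables, that is [P] itself. *)
Lemma sum_coeff_alternant (K : comNzRingType) n d (P : {mpoly K[n]}) :
    P \is symmetric -> (msize P <= d)%N ->
  \sum_(m : 'X_{1..n < d}) P@_m *: map_mpoly (intr : int -> K) (alternant m)
  = P * map_mpoly intr (vandermonde n).
Proof.
move=> /issymP P_sym le_Pd.
rewrite vandermonde_alternant map_alternant mulr_sumr.
under eq_bigr do rewrite map_alternant scaler_sumr.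
rewrite exchange_big; apply: eq_bigr => s _ /=.
rewrite -{2}(P_sym s) {2}(mpolywE le_Pd) mulrCA raddf_sum mulr_suml mulr_sumr.
apply: eq_bigr => m _.
by rewrite /= msymZ mpolyXD add0m msymM -scalerAl -scalerAr.
Qed.

(** The leading coefficient is [1] or [-1], according to which of the two
variables is the larger monomial, so it is regular in any ring. *)
Lemma lreg_subX (K : comNzRingType) n (i j : 'I_n) :
  i != j -> GRing.lreg ('X_j - 'X_i : {mpoly K[n]}).
Proof.
wlog lt_ij : i j / (U_(i)%MM < U_(j)%MM)%O => [wlg ne_ij|_].
  have [lt_ij|lt_ji|/eqP] := ltgtP (U_(i)%MM : 'X_{1..n}) U_(j)%MM.
  - exact: wlg.
  - by rewrite -opprB; apply/lregN/wlg => //; rewrite eq_sym.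
  - by rewrite eq_mnm1 (negPf ne_ij).
apply: lreg_mleadc; rewrite mleadDl ?mleadN ?mleadXm //.
rewrite mcoeffB !mcoeffX eqxx eq_sym -[_ == _]negbK.
rewrite eq_sym (lt_eqF lt_ij) subr0; exact: lreg1.
Qed.

Lemma lreg_vandermonde (K : comNzRingType) n :
  GRing.lreg (map_mpoly (intr : int -> K) (vandermonde n)).
Proof.
have [b ->] := vandermondeE n; rewrite rmorphM rmorph_sign.
apply: lregM; first exact: lreg_sign.
rewrite rmorph_prod; elim/big_ind: _ => [|p q|i _]; [exact: lreg1|exact: lregM|].
rewrite rmorph_prod; elim/big_ind: _ => [|p q|j lt_ij]; [exact: lreg1|exact: lregM|].
rewrite rmorphB /= !map_mpolyX; apply: lreg_subX.
by rewrite neq_ltn lt_ij.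
Qed.

Lemma symmetric_schur_expansion (K : comNzRingType) n d (P : {mpoly K[n]}) :
    P \is symmetric -> (msize P <= d)%N ->
  P = \sum_(m : 'X_{1..n < d}) P@_m *: schur K m.
Proof.
move=> P_sym le_Pd; apply: (@lreg_vandermonde K n).
rewrite mulrC -(sum_coeff_alternant P_sym le_Pd) mulr_sumr.
apply: eq_bigr => m _.
by rewrite -scalerAr -schur_intE rmorphM mulrC.
Qed.

(** * Partial sums *)

Definition psum (s : seq nat) (k : nat) : nat := sumn (take k s).

Lemma psumS s k : psum s k.+1 = (psum s k + nth 0 s k)%N.
Proof.
rewrite /psum; elim: s k => [|x s IHs] [|k] //=; first by rewrite take0 addn0.
by rewrite IHs addnA.
Qed.

Lemma leq_psum s k l : (k <= l)%N -> (psum s k <= psum s l)%N.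
Proof.
move=> /subnK <-; elim: (l - k)%N => // d IHd.
by rewrite addSn psumS (leq_trans IHd) ?leq_addr.
Qed.

Lemma psum_oversize s k : (size s <= k)%N -> psum s k = sumn s.
Proof. by move=> le_sk; rewrite /psum take_oversize. Qed.

Lemma psum_mdeg n (g : 'X_{1..n}) k : (n <= k)%N -> psum g k = mdeg g.
Proof. by move=> le_nk; rewrite psum_oversize ?size_tuple // sumnE. Qed.

Lemma leq_psum_mdeg n (g : 'X_{1..n}) k : (psum g k <= mdeg g)%N.
Proof.
by rewrite -(psum_mdeg g (leq_maxr k n)) leq_psum ?leq_maxl.
Qed.

Lemma psum_inj n (g h : 'X_{1..n}) : psum g =1 psum h -> g = h.
Proof.
move=> eq_gh; apply/mnmP => i; rewrite !(mnm_nth 0%N).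
by have := eq_gh i.+1; rewrite !psumS eq_gh => /addnI.
Qed.

Lemma psum_composition n (al : composition n) k :
  (size al <= k)%N -> psum al k = n.
Proof.
by move=> le_k; rewrite psum_oversize //; case: (al) => s /= /andP[_ /eqP].
Qed.

Lemma ltn_psum_composition n (al : composition n) k :
  (k < size al)%N -> (psum al k < psum al k.+1)%N.
Proof.
move=> lt_k; rewrite psumS -addn1 leq_add2l.
by case: al lt_k => s /= /andP[/allP pos_s _] lt_k; apply/pos_s/mem_nth.
Qed.

Lemma psum_pad n (al : composition n) : psum (pad al) =1 psum al.
Proof.
elim=> [|k IHk]; first by rewrite /psum !take0.
rewrite !psumS IHk; have [lt_kn|le_nk] := ltnP k n; last first.
  by rewrite !nth_default ?size_tuple // (leq_trans (size_composition al)).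
by rewrite -(mnm_nth 0%N (pad al) (Ordinal lt_kn)) mnmE.
Qed.

(** An initial segment of ['I_n] is determined by its size.  Both passages
between words and contents are inversions of this kind: a nondecreasing word
is recovered from its level sets, which are initial segments. *)
Lemma mem_initial n (D : {set 'I_n}) (i : 'I_n) :
  (forall j k : 'I_n, (j <= k)%N -> k \in D -> j \in D) ->
  (i \in D) = (i < #|D|)%N.
Proof.
move=> downD; have card_below k : (k <= n)%N -> #|[set j : 'I_n | (j < k)%N]| = k.
  move=> le_kn; rewrite -sum1dep_card -(big_ord_widen _ (fun=> 1%N)) //.
  by rewrite sum1_card card_ord.
apply/idP/idP => [Di|].
  rewrite -[i.+1]card_below ?ltn_ord //; apply/subset_leq_card/subsetP => j.
  by rewrite inE ltnS => /downD; apply.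
apply: contraLR => notDi; rewrite -leqNgt.
rewrite -[X in (_ <= X)%N]card_below ?(ltnW (ltn_ord i)) //.
apply/subset_leq_card/subsetP => j Dj; rewrite inE ltnNge.
by apply: contra notDi => /downD; apply.
Qed.

(** * Nondecreasing words and their contents *)

Definition content n (a : {ffun 'I_n -> 'I_n}) : 'X_{1..n} :=
  [multinom #|[set p | a p == j]| | j < n].

Lemma prod_content (R : comNzRingType) n (a : {ffun 'I_n -> 'I_n}) :
  \prod_(p < n) 'X_(a p) = 'X_[content a] :> {mpoly R[n]}.
Proof.
rewrite mpolyXE_id (partition_big a xpredT) //=; apply: eq_bigr => j _.
rewrite (eq_bigr (fun=> 'X_j)) => [|p /eqP-> //].
by rewrite mnmE prodr_const cardsE.
Qed.

Lemma psum_content n (a : {ffun 'I_n -> 'I_n}) k :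
  psum (content a) k = #|[set p | a p < k]%N|.
Proof.
elim: k => [|k IHk]; first by rewrite /psum take0 eq_card0 // => p; rewrite inE.
have -> : [set p | a p < k.+1]%N = [set p | a p < k]%N :|: [set p | a p == k :> nat].
  by apply/setP => p; rewrite !inE ltnS leq_eqVlt orbC.
rewrite cardsU disjoint_setI0 ?cards0 ?subn0 ?psumS ?IHk; last first.
  by rewrite -setI_eq0; apply/eqP/setP => p; rewrite !inE; lia.
congr (_ + _)%N; have [lt_kn|le_nk] := ltnP k n.
  by rewrite -(mnm_nth 0%N (content a) (Ordinal lt_kn)) mnmE.
rewrite nth_default ?size_tuple // eq_card0 // => p.
by rewrite inE; apply/negP => /eqP def_k; have := ltn_ord (a p); lia.
Qed.

Lemma mdeg_content n (a : {ffun 'I_n -> 'I_n}) : mdeg (content a) = n.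
Proof.
rewrite -(psum_mdeg _ (leqnn n)) psum_content -[RHS]card_ord -cardsT.
by apply: eq_card => p; rewrite !inE ltn_ord.
Qed.

Definition nondecr n (a : {ffun 'I_n -> 'I_n}) :=
  forall p q : 'I_n, (p <= q)%N -> (a p <= a q)%N.

Lemma ltn_psum_content n (a : {ffun 'I_n -> 'I_n}) (p : 'I_n) k :
  nondecr a -> (p < psum (content a) k)%N = (a p < k)%N.
Proof.
move=> a_incr; rewrite psum_content -mem_initial ?inE // => q r le_qr.
by rewrite !inE; apply/leq_ltn_trans/a_incr.
Qed.

(** The nondecreasing word of content [g]: the letter at position [p] is the
number of letters whose block of occurrences ends at or before [p].  When
[mdeg g = n] this number is below [n], so that [insubd] returns it unchanged. *)
Definition word n (g : 'X_{1..n}) : {ffun 'I_n -> 'I_n} :=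
  [ffun p : 'I_n => insubd p #|[set j : 'I_n | psum g j.+1 <= p]%N|].

(** A Galois connection characterizing [word g]; it does for [word g] what
[ltn_psum_content] does for an arbitrary nondecreasing word. *)
Lemma ltn_word n (g : 'X_{1..n}) (p : 'I_n) k :
  mdeg g = n -> (word g p < k)%N = (p < psum g k)%N.
Proof.
move=> deg_g; rewrite ffunE; set D := [set j : 'I_n | _].
have D_initial (j : 'I_n) : (j \in D) = (j < #|D|)%N.
  apply: mem_initial => {}j l le_jl; rewrite !inE.
  by apply/leq_trans/leq_psum.
have lt_Dn : (#|D| < n)%N.
  have n_gt0 : (0 < n)%N by case: (p) => q /=; apply: leq_ltn_trans.
  have lt_n'n : (n.-1 < n)%N by rewrite prednK.
  rewrite ltnNge; apply/negP => le_nD; have := D_initial (Ordinal lt_n'n).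
  by rewrite inE /= (leq_trans lt_n'n) // prednK // psum_mdeg // deg_g leqNgt ltn_ord.
rewrite val_insubd lt_Dn.
have [lt_kn|le_nk] := leqP k n; last first.
  by rewrite psum_mdeg ?deg_g ?ltn_ord ?(ltn_trans lt_Dn) // ltnW.
case: k lt_kn => [|k] lt_kn; first by rewrite /psum take0.
by rewrite ltnS leqNgt -(D_initial (Ordinal lt_kn)) inE -ltnNge.
Qed.

Lemma word_nondecr n (g : 'X_{1..n}) : mdeg g = n -> nondecr (word g).
Proof.
move=> deg_g p q le_pq; rewrite -ltnS ltn_word //.
by apply: leq_ltn_trans le_pq _; rewrite -ltn_word.
Qed.

Lemma wordK n (g : 'X_{1..n}) : mdeg g = n -> content (word g) = g.
Proof.
move=> deg_g; apply: psum_inj => k.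
have := leq_psum_mdeg g k; have := leq_psum_mdeg (content (word g)) k.
rewrite mdeg_content deg_g => le1 le2; have w_nd := word_nondecr deg_g.
have lt_iff p : (p < n)%N -> (p < psum (content (word g)) k)%N = (p < psum g k)%N.
  by move=> lt_pn; rewrite (ltn_psum_content (Ordinal lt_pn)) // ltn_word.
apply/eqP; rewrite eqn_leq; apply/andP; split; rewrite leqNgt; apply/negP => lt_.
  by have := lt_iff _ (leq_trans lt_ le1); rewrite lt_ ltnn.
by have := lt_iff _ (leq_trans lt_ le2); rewrite lt_ ltnn.
Qed.

Lemma contentK n (a : {ffun 'I_n -> 'I_n}) : nondecr a -> word (content a) = a.
Proof.
move=> a_nd; apply/ffunP => p; apply/val_inj/eqP.
have lt_iff k := ltn_word p k (mdeg_content a).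
rewrite eqn_leq -ltnS -[X in _ && X]ltnS lt_iff ltn_psum_content //= ltnSn /=.
by rewrite -(ltn_psum_content _ _ a_nd) -lt_iff ltnSn.
Qed.

Definition admissible n (al : composition n) (g : 'X_{1..n}) :=
  forall i, exists k, psum g k = psum al i.

(** A nondecreasing word has an ascent between positions [s-1] and [s]
exactly when [s] is a partial sum of its content. *)
Lemma F_seqP n (al : composition n) (a : {ffun 'I_n -> 'I_n}) :
  reflect (nondecr a /\ admissible al (content a)) (F_seq al a).
Proof.
apply: (iffP forallP) => [Fa | [a_nd adm_a] p].
  have a_nd : nondecr a.
    move=> p q /subnK; move: (q - p)%N => d; elim: d q => [|d IHd] q def_q.
      by rewrite (_ : p = q) //; apply: val_inj.
    have lt_q : (d + p < n)%N by apply: leq_trans (ltn_ord q); rewrite -def_q.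
    apply: leq_trans (IHd (Ordinal lt_q) erefl) _.
    have /forallP/(_ q)/implyP := Fa (Ordinal lt_q).
    by rewrite -def_q => /(_ (eqxx _))/andP[].
  split=> // i; have [le_i | lt_i] := leqP (size al) i.
    by exists n; rewrite psum_mdeg // mdeg_content psum_composition.
  case: i lt_i => [|i] lt_i; first by exists 0%N; rewrite /psum !take0.
  have s_gt0 := leq_ltn_trans (leq0n _) (ltn_psum_composition (ltnW lt_i)).
  have := ltn_psum_composition lt_i.
  move/leq_trans/(_ (leq_psum al lt_i)); rewrite (psum_composition (leqnn _)) => lt_sn.
  set s := psum al i.+1 in s_gt0 lt_sn *.
  have lt_s'n : (s.-1 < n)%N by rewrite prednK // ltnW.
  have /forallP/(_ (Ordinal lt_sn))/implyP := Fa (Ordinal lt_s'n).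
  rewrite /= prednK // => /(_ (eqxx _))/andP[_ /implyP].
  have -> : s \in comp_set al.
    by apply/mapP; exists i.+1; rewrite // mem_iota /=; lia.
  (* The letter starting at position s: the smaller ones fill 0, ..., s-1. *)
  move=> /(_ isT) lt_a; exists (a (Ordinal lt_sn) : nat).
  move: lt_a; rewrite -ltn_psum_content //= prednK //.
  have := ltn_psum_content (Ordinal lt_sn) (a (Ordinal lt_sn)) a_nd.
  by rewrite ltnn /=; lia.
apply/forallP => q; apply/implyP => /eqP def_q.
rewrite a_nd ?def_q //=; apply/implyP => /mapP[i _ def_i].
have [k def_k] := adm_a i.
have lt_pk : (a p < k)%N by rewrite -ltn_psum_content // def_k -[psum _ _]def_i.
apply: leq_trans lt_pk _.
by rewrite leqNgt -ltn_psum_content // def_k -[psum _ _]def_i def_q ltnn.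
Qed.

(** * The sign-reversing involution *)

(** On exponents [g + delta] this is a plain exchange of two adjacent entries;
the shifts by one compensate for the slope of [delta]. *)
Definition swap_parts n (j0 j1 : 'I_n) (g : 'X_{1..n}) : 'X_{1..n} :=
  [multinom if t == j0 then (g j1).-1 else if t == j1 then (g j0).+1 else g t
   | t < n].

Lemma swap_partsK n (j0 j1 : 'I_n) (g : 'X_{1..n}) :
  j0 != j1 -> (0 < g j1)%N -> swap_parts j0 j1 (swap_parts j0 j1 g) = g.
Proof.
move=> ne_j gj1_gt0; apply/mnmP => t; rewrite !mnmE !eqxx (eq_sym j1) (negPf ne_j).
by case: eqP => [->|_] //; case: eqP => [->|//]; rewrite prednK.
Qed.

Lemma alternant_swap n (j0 j1 : 'I_n) (g : 'X_{1..n}) :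
    j1 = j0.+1 :> nat -> (0 < g j1)%N ->
  alternant (swap_parts j0 j1 g) = - alternant g.
Proof.
move=> def_j1 gj1_gt0; rewrite /alternant.
have ne_j : j0 != j1 by rewrite -val_eqE /= def_j1 neq_ltn ltnSn.
set M := (X in _ = - \det X).
suff -> : (\matrix_(i, j) 'X_i ^+ (swap_parts j0 j1 g j + (n - j.+1)))
          = col_perm (tperm j0 j1) M.
  by rewrite col_permE det_mulmx det_perm tpermV odd_tperm ne_j mulrN1.
apply/matrixP => i t; rewrite !mxE !mnmE; congr (_ ^+ _).
have := ltn_ord j1; case: tpermP => [->|->|/eqP/negPf-> /eqP/negPf-> //].
  by rewrite eqxx; lia.
by rewrite eq_sym (negPf ne_j) eqxx; lia.
Qed.

(** Only one partial sum moves: it is reflected inside the interval between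
its two neighbours. *)
Lemma psum_swap n (j0 j1 : 'I_n) (g : 'X_{1..n}) k :
    j1 = j0.+1 :> nat -> (0 < g j1)%N ->
  psum (swap_parts j0 j1 g) k
  = if k == j1 then (psum g j0 + (g j1).-1)%N else psum g k.
Proof.
move=> def_j1 gj1_gt0.
have nth_swap t : nth 0%N (swap_parts j0 j1 g) t =
    if t == j0 then (g j1).-1 else if t == j1 then (g j0).+1 else nth 0%N g t.
  have [lt_tn|le_nt] := ltnP t n.
    by rewrite -(mnm_nth 0%N _ (Ordinal lt_tn)) mnmE (mnm_nth 0%N g (Ordinal lt_tn)).
  have := ltn_ord j0; have := ltn_ord j1.
  by rewrite !nth_default ?size_tuple //; do 2?case: eqP; lia.
elim: k => [|k IHk]; first by rewrite def_j1 /psum !take0.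
rewrite !psumS {}IHk nth_swap def_j1 eqSS.
have [->|ne_k0] := eqVneq k j0; first by rewrite ltn_eqF.
have [->|ne_k1] := eqVneq k j0.+1; last by [].
rewrite psumS -def_j1 -!mnm_nth; lia.
Qed.

(** The index [i] is the first one where the partial sums of [g] and [al]
differ, and [j1] is the part of [g] that completes the [i]-th partial sum of
[al].  The exchange of parts [j0] and [j1] changes the partial sum of index
[j1] only; the bound [i <= j1] keeps those below index [i] intact. *)
Definition pivot n (al : composition n) (g : 'X_{1..n})
    (v : 'I_n.+1 * 'I_n * 'I_n) : bool :=
  let: (i, j0, j1) := v in
  [&& j1 == j0.+1 :> nat, (i <= j1)%N, (psum g j1 < psum al i)%N,
      psum g j1.+1 == psum al i
    & [forall t : 'I_n.+1, (t < i)%N ==> (psum g t == psum al t)]].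

Lemma pivotP n (al : composition n) (g : 'X_{1..n}) (i : 'I_n.+1) (j0 j1 : 'I_n) :
  reflect [/\ j1 = j0.+1 :> nat, (i <= j1)%N, (psum g j1 < psum al i)%N,
              psum g j1.+1 = psum al i
            & forall t, (t < i)%N -> psum g t = psum al t]
          (pivot al g (i, j0, j1)).
Proof.
apply: (iffP and5P) => [[/eqP def_j1 le_ij lt_j /eqP eq_j /forallP eq_t]|].
  split=> // t lt_ti; apply/eqP.
  have lt_tn : (t < n.+1)%N := ltn_trans lt_ti (ltn_ord i).
  by have /implyP := eq_t (Ordinal lt_tn); apply.
case=> -> le_ij lt_j -> eq_t; split=> //.
by apply/forallP => t; apply/implyP => /eq_t/eqP.
Qed.

Lemma pivot_uniq n (al : composition n) (g : 'X_{1..n}) u v :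
  pivot al g u -> pivot al g v -> u = v.
Proof.
case: u v => [[i j0] j1] [[i' j0'] j1'].
move=> /pivotP[def_j le_ij lt_j eq_j eq_t] /pivotP[def_j' le_ij' lt_j' eq_j' eq_t'].
have lt_i := leq_ltn_trans (leq_psum g le_ij) lt_j.
have lt_i' := leq_ltn_trans (leq_psum g le_ij') lt_j'.
have eq_i : i = i' :> nat.
  case: (ltngtP i i') => // [/eq_t' eq_i|/eq_t eq_i].
    by rewrite eq_i ltnn in lt_i.
  by rewrite eq_i ltnn in lt_i'.
rewrite -eq_i in lt_j' eq_j'.
have eq_j1 : j1 = j1' :> nat.
  case: (ltngtP j1 j1') => // [/(leq_psum g)|/(leq_psum g)].
    by rewrite eq_j leqNgt lt_j'.
  by rewrite eq_j' leqNgt lt_j.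
by rewrite (val_inj eq_i) (val_inj eq_j1) (_ : j0 = j0') //; apply: val_inj => /=; lia.
Qed.

(** At the first index [i] of disagreement the partial sum of [g] must be the
smaller one: otherwise [g] would jump over the [i]-th partial sum of [al],
which admissibility forces it to attain.  The part [j1] is then the one before
the least [m] at which [g] attains it. *)
Lemma pivot_exists n (al : composition n) (g : 'X_{1..n}) :
    mdeg g = n -> admissible al g -> g != pad al ->
  exists v, pivot al g v.
Proof.
move=> deg_g adm_g ne_g.
have ex_i : exists i, psum g i != psum al i.
  have /existsP[i ne_i] : [exists i : 'I_n.+1, psum g i != psum al i].
    apply: contraNT ne_g => /existsPn eq_g; apply/eqP/psum_inj => k.
    rewrite psum_pad; have [lt_kn|le_nk] := ltnP k n.
      by apply/eqP; have := eq_g (Ordinal (ltnW lt_kn : k < n.+1)%N); rewrite negbK.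
    by rewrite psum_mdeg // psum_composition // (leq_trans (size_composition al)).
  by exists i.
case: (ex_minnP ex_i) => i ne_i min_i.
have eq_lt t : (t < i)%N -> psum g t = psum al t.
  by move=> lt_ti; apply/eqP; apply: contraLR lt_ti => /min_i; rewrite -leqNgt.
have i_gt0 : (0 < i)%N.
  by case: (i) ne_i => //; rewrite /psum !take0.
have [le_n|lt_in] := leqP n i.
  case/negP: ne_i.
  by rewrite psum_mdeg // psum_composition ?deg_g // (leq_trans (size_composition al)).
have lt_i : (psum g i < psum al i)%N.
  rewrite ltn_neqAle ne_i leqNgt; apply/negP => gt_i.
  have [k eq_k] := adm_g i.
  have lt_ki : (k < i)%N.
    by rewrite ltnNge; apply/negP => /(leq_psum g); rewrite eq_k leqNgt gt_i.
  have le_i'i : (psum al i.-1 <= psum al i)%N by rewrite leq_psum ?leq_pred.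
  have le_ki' : (psum g k <= psum g i.-1)%N by rewrite leq_psum // -ltnS prednK.
  have [lt_size|le_size] := ltnP i.-1 (size al).
    have := ltn_psum_composition lt_size; rewrite prednK //.
    by move: le_ki'; rewrite eq_k eq_lt ?prednK //; lia.
  have := leq_psum_mdeg g i; rewrite deg_g leqNgt.
  rewrite -[X in (X < _)%N](@psum_composition _ al i) ?gt_i //.
  by rewrite (leq_trans le_size) ?leq_pred.
have ex_m : exists m, (psum al i <= psum g m)%N.
  by have [k <-] := adm_g i; exists k.
case: (ex_minnP ex_m) => m le_m min_m.
have lt_im : (i < m)%N.
  by rewrite ltnNge; apply/negP => /(leq_psum g)/(leq_trans le_m); rewrite leqNgt lt_i.
have lt_m' : (psum g m.-1 < psum al i)%N.
  by rewrite ltnNge; apply/negP => /min_m; lia.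
have eq_m : psum g m = psum al i.
  apply/eqP; rewrite eqn_leq le_m andbT; have [k eq_k] := adm_g i.
  by rewrite -eq_k leq_psum // min_m // eq_k.
have lt_j1 : (m.-1 < n)%N.
  rewrite ltnNge; apply/negP => le_n.
  by move: lt_m' le_m; rewrite !psum_mdeg //; lia.
have lt_j0 : (m.-2 < n)%N by lia.
exists (Ordinal (ltnW lt_in : i < n.+1)%N, Ordinal lt_j0, Ordinal lt_j1).
by apply/pivotP; split=> //=; rewrite ?prednK //; lia.
Qed.

Lemma pivot_gt0 n (al : composition n) (g : 'X_{1..n}) i j0 j1 :
  pivot al g (i, j0, j1) -> (0 < g j1)%N.
Proof.
by move=> /pivotP[_ _ lt_j eq_j _]; move: lt_j; rewrite (mnm_nth 0%N) -eq_j psumS; lia.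
Qed.

Lemma mdeg_swap n (j0 j1 : 'I_n) (g : 'X_{1..n}) :
  j1 = j0.+1 :> nat -> (0 < g j1)%N -> mdeg (swap_parts j0 j1 g) = mdeg g.
Proof.
move=> def_j1 gj1_gt0; rewrite -!(psum_mdeg _ (leqnn n)) psum_swap //.
by rewrite gtn_eqF.
Qed.

Lemma psum_swap_lt n (j0 j1 : 'I_n) (g : 'X_{1..n}) :
    j1 = j0.+1 :> nat -> (0 < g j1)%N ->
  (psum (swap_parts j0 j1 g) j1 < psum g j1.+1)%N.
Proof.
move=> def_j1 gj1_gt0; rewrite psum_swap // eqxx psumS -mnm_nth.
have := @leq_psum g j0 j1; lia.
Qed.

Lemma pivot_swap n (al : composition n) (g : 'X_{1..n}) i j0 j1 :
  pivot al g (i, j0, j1) -> pivot al (swap_parts j0 j1 g) (i, j0, j1).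
Proof.
move=> piv; have g_gt0 := pivot_gt0 piv.
case/pivotP: piv => def_j1 le_ij lt_j eq_j eq_t; apply/pivotP; split=> //.
- by rewrite -eq_j psum_swap_lt.
- by rewrite psum_swap // gtn_eqF.
- by move=> t lt_ti; rewrite psum_swap // ltn_eqF ?eq_t // (leq_trans lt_ti).
Qed.

Lemma admissible_swap n (al : composition n) (g : 'X_{1..n}) i j0 j1 :
  pivot al g (i, j0, j1) -> admissible al g ->
  admissible al (swap_parts j0 j1 g).
Proof.
move=> piv adm_g t; have g_gt0 := pivot_gt0 piv.
case/pivotP: piv => def_j1 le_ij lt_j eq_j eq_t.
have [lt_ti|le_it] := ltnP t i.
  by exists t; rewrite psum_swap // ltn_eqF ?eq_t // (leq_trans lt_ti).
have [k eq_k] := adm_g t; exists k; rewrite psum_swap // ifN //.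
apply: contraL lt_j => /eqP <-; rewrite -leqNgt eq_k.
exact: leq_psum.
Qed.

(** This is why the cancellation is carried out over the integers: fixed points
of the involution need no separate treatment. *)
Lemma eqN_mpoly_int n (p : {mpoly int[n]}) : p = - p -> p = 0.
Proof.
move=> eqNp; apply/mpolyP => m; rewrite mcoeff0.
by have /(congr1 (mcoeff m)) := eqNp; rewrite mcoeffN; lia.
Qed.

(** The exchange of parts is transported to words, which form a finite type,
through the inverse maps [content] and [word]. *)
Lemma sum_pivot_alternant n (al : composition n) v :
  \sum_(a | F_seq al a && pivot al (content a) v) alternant (content a) = 0.
Proof.
case: v => [[i j0] j1]; apply: eqN_mpoly_int; rewrite -[in RHS]sumrN.
pose tau (a : {ffun 'I_n -> 'I_n}) := word (swap_parts j0 j1 (content a)).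
have tauP a : F_seq al a && pivot al (content a) (i, j0, j1) ->
    [/\ j1 = j0.+1 :> nat, (0 < content a j1)%N,
        content (tau a) = swap_parts j0 j1 (content a), tau (tau a) = a
      & F_seq al (tau a) && pivot al (content (tau a)) (i, j0, j1)].
  case/andP => /F_seqP[a_nd adm_a] piv; have g_gt0 := pivot_gt0 piv.
  have [def_j1 _ _ _ _] := pivotP _ _ _ _ _ piv.
  have deg_s : mdeg (swap_parts j0 j1 (content a)) = n.
    by rewrite mdeg_swap // mdeg_content.
  have ct : content (tau a) = swap_parts j0 j1 (content a) by apply: wordK.
  split=> //.
    rewrite /tau ct swap_partsK ?contentK //.
    by rewrite -val_eqE /= def_j1 neq_ltn ltnSn.
  rewrite ct pivot_swap // andbT; apply/F_seqP; split; first exact: word_nondecr.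
  by rewrite ct; apply: (admissible_swap piv).
rewrite (reindex_onto tau tau) => [|a /tauP[]//]; apply: eq_big => [a|a].
  apply/andP/idP => [[Qta /eqP tauK]|Qa]; last by have [_ _ _ -> ->] := tauP a Qa.
  by have [_ _ _ _] := tauP _ Qta; rewrite tauK.
case/andP=> Qta /eqP tauK.
have [_ _ _ _] := tauP _ Qta; rewrite tauK => /tauP[def_j1 g_gt0 -> _ _].
exact: alternant_swap.
Qed.

Lemma sum_fundamental_alternant n (al : composition n) :
  \sum_(a : {ffun 'I_n -> 'I_n} | F_seq al a) alternant (content a)
  = alternant (pad al).
Proof.
have pad_content : content (word (pad al)) = pad al by rewrite wordK ?mdeg_pad.
rewrite (bigD1 (word (pad al))) /=; last first.
  apply/F_seqP; split; first by apply/word_nondecr/mdeg_pad.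
  by move=> i; exists i; rewrite pad_content psum_pad.
rewrite pad_content -[RHS]addr0; congr (_ + _).
rewrite (partition_big (fun a => [pick v | pivot al (content a) v]) isSome) /=;
  last first.
  move=> a /andP[/F_seqP[a_nd adm_a] ne_a]; case: pickP => // no_piv.
  have [] := pivot_exists (mdeg_content a) adm_a; last by move=> v; rewrite no_piv.
  by apply: contraNneq ne_a => <-; rewrite contentK.
(* Each summand left over has exactly one pivot, which indexes the blocks. *)
apply: big1 => -[v|//] _; rewrite -[RHS](sum_pivot_alternant al v).
apply: eq_bigl => a; rewrite -andbA; apply: andb_id2l => Fa.
apply/andP/idP => [[_]|piv].
  by case: pickP => // u piv /eqP[<-].
split; last by case: pickP => [u /pivot_uniq/(_ piv)->//|/(_ v)]; rewrite piv.
apply: contraTneq piv => ->; rewrite pad_content.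
case: v => [[i j0] j1]; apply/negP => /pivotP[_ le_ij lt_j _ _].
by have := leq_psum (pad al) le_ij; rewrite [psum _ i]psum_pad leqNgt lt_j.
Qed.

(** * The expansion theorem *)

Lemma schur_fundamental (K : comNzRingType) n (al : composition n) :
  \sum_(a : {ffun 'I_n -> 'I_n} | F_seq al a) schur K (content a)
  = schur K (pad al).
Proof.
rewrite -raddf_sum /=; congr map_mpoly; apply: schur_int_unique.
rewrite mulr_suml -sum_fundamental_alternant; apply: eq_bigr => a _.
exact: schur_intE.
Qed.

Lemma fundamental_content (K : comNzRingType) n (al : composition n) :
  fundamental K al = \sum_(a : {ffun 'I_n -> 'I_n} | F_seq al a) 'X_[content a].
Proof. by apply: eq_bigr => a _; rewrite prod_content. Qed.

Theorem theorem1 (K : comNzRingType) (n : nat) (n_gt0 : (0 < n)%N)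
    (P : {mpoly K[n]}) (a : composition n -> K)
    (P_sym : P \is symmetric) (P_homog : P \is n.-homog)
    (P_F : P = \sum_(al : composition n) a al *: fundamental K al) :
  P = \sum_(al : composition n) a al *: schur K (pad al).
Proof.
have le_P : (msize P <= n.+1)%N.
  rewrite msizeE; apply/bigmax_leqP_seq => m m_P _.
  by rewrite ltnS (dhomog_mf P_homog m_P).
rewrite (symmetric_schur_expansion P_sym le_P).
under eq_bigr => m _ do rewrite {1}P_F (raddf_sum (mcoeff m)) scaler_suml.
rewrite exchange_big /=; apply: eq_bigr => al _.
under eq_bigr => m _ do rewrite mcoeffZ -scalerA.
rewrite -scaler_sumr -schur_fundamental; congr (_ *: _).
under eq_bigr => m _ do
  rewrite fundamental_content (raddf_sum (mcoeff m)) scaler_suml.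
rewrite exchange_big /=; apply: eq_bigr => b _.
have lt_b : (mdeg (content b) < n.+1)%N by rewrite mdeg_content.
rewrite (bigD1 (BMultinom lt_b)) //= mcoeffX eqxx scale1r big1 ?addr0 // => m.
rewrite -val_eqE /= mcoeffX eq_sym => /negPf->; exact: scale0r.
Qed.
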